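(* There is an infinite sequence of integers $r$ for which there are $\exp(r^{0.5-o(1)})$ non-isomorphic maximal elements in the $r$-Ryser poset.
   Context: A hypergraph is a family of subsets (edges) of a vertex set; here hypergraphs may be finite or countably infinite. It is $r$-uniform if every edge has $r$ vertices. It is $r$-partite if its vertex set can be partitioned into $r$ sets (sides) so that every edge contains at most one vertex from each side. A cover is a set of vertices meeting every edge; $\tau(\mathcal H)$ is the minimum size of a cover. A hypergraph is intersecting if its largest set of pairwise disjoint edges has size $1$. An intersecting $r$-Ryser hypergraph is an $r$-partite $r$-uniform intersecting hypergraph $\mathcal H$ with $\tau(\mathcal H)=r-1$. The $r$-Ryser poset: consider all (finite or countably infinite) intersecting $r$-Ryser hypergraphs, up to isomorphism, isolated vertices being disregarded. Say $\mathcal H$ is contained in $\mathcal H'$ if $\mathcal H$ is isomorphic to a sub-hypergraph of $\mathcal H'$ (given by a subset of the edges). Define the equivalence relation $\mathcal H\sim\mathcal H'$ if $\mathcal H$ is contained in $\mathcal H'$ and $\mathcal H'$ is contained in $\mathcal H$. The elements of the $r$-Ryser poset are the equivalence classes of $\sim$ (non-isomorphic elements means distinct equivalence classes), ordered by containment. The term $o(1)$ tends to $0$ as $r\to\infty$ along the sequence. *)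

(* Defs.v *)
From mathcomp Require Import all_boot all_order all_algebra.
From mathcomp Require Import all_classical all_reals all_analysis.

Set Implicit Arguments.
Unset Strict Implicit.
Unset Printing Implicit Defensive.

Local Open Scope classical_set_scope.
Local Open Scope card_scope.

Record hypergraph := Hypergraph { vertex : Type; edges : set (set vertex) }.
Arguments edges : clear implicits.

Definition uniform (r : nat) (H : hypergraph) :=
  forall e, edges H e -> e #= `I_r.

(* [side] is the partition of the vertex set into r sides; a side may be empty
   here, but r-uniformity and one edge force all the sides to be inhabited. *)
Definition partite (r : nat) (H : hypergraph) :=
  exists side : vertex H -> 'I_r,
    forall e, edges H e -> forall x y, e x -> e y -> side x = side y -> x = y.

Definition is_cover (H : hypergraph) (C : set (vertex H)) :=
  forall e, edges H e -> C `&` e !=set0.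

Definition cover_number (H : hypergraph) (t : nat) :=
  (exists C : set (vertex H), is_cover C /\ C #= `I_t) /\
  (forall C : set (vertex H), is_cover C -> `I_t #<= C).

Definition is_matching (H : hypergraph) (M : set (set (vertex H))) :=
  M `<=` edges H /\ trivIset M id.

Definition matching_number (H : hypergraph) (m : nat) :=
  (exists M : set (set (vertex H)), is_matching M /\ M #= `I_m) /\
  (forall M : set (set (vertex H)), is_matching M -> M #<= `I_m).

Definition intersecting (H : hypergraph) := matching_number H 1.

(* The vertex type is arbitrary since isolated vertices are disregarded: with
   finite edges, countably many edges have countably many vertices in total.
   [t.+1 = r] states [t = r - 1] without truncated subtraction. *)
Definition intersecting_ryser (r : nat) (H : hypergraph) :=
  [/\ countable (edges H), uniform r H, partite r H, intersecting H
    & exists2 t, cover_number H t & t.+1 = r].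

Definition non_isolated (H : hypergraph) : set (vertex H) :=
  \bigcup_(e in edges H) e.
Arguments non_isolated : clear implicits.

(* [f] is a total function, but its values at isolated vertices play no role. *)
Definition isomorphic (H H' : hypergraph) :=
  exists f : vertex H -> vertex H',
    set_bij (non_isolated H) (non_isolated H') f /\
    [set f @` e | e in edges H] = edges H'.

Definition contained (H H' : hypergraph) :=
  exists2 F : set (set (vertex H')),
    F `<=` edges H' & isomorphic H (Hypergraph F).

Definition ryser_equiv (H H' : hypergraph) := contained H H' /\ contained H' H.

Definition ryser_class (r : nat) (H : hypergraph) : set hypergraph :=
  [set H' | intersecting_ryser r H' /\ ryser_equiv H H'].

Definition ryser_poset (r : nat) : set (set hypergraph) :=
  [set ryser_class r H | H in [set H | intersecting_ryser r H]].

(* Containment of classes; independent of the representatives. *)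
Definition ryser_le (X Y : set hypergraph) :=
  exists H H', [/\ X H, Y H' & contained H H'].

Definition ryser_maximal (r : nat) : set (set hypergraph) :=
  [set X | ryser_poset r X /\
           forall Y, ryser_poset r Y -> ryser_le X Y -> Y = X].

(* Main.v *)
(** Take r = p^2 + 1 with p prime, and F the field with p^2 elements. A projective
    plane of order p^2 with a point and the lines through it removed is an
    intersecting r-Ryser hypergraph, and it is maximal: any further edge would be a
    blocking set of p^2 + 1 points, hence a line. The Andre planes give one such
    hypergraph for every set S of nonzero norms from F to its prime field: the lines
    are y = m x + b, except that x is replaced by x^p when the norm of m lies in S.
    An isomorphism between two of them that fixes four suitable vertices is additive
    on the coordinates, hence the identity, so at most (r p^2)^4 of the 2^(p-1)
    hypergraphs lie in one isomorphism class. *)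

Require Import Defs.
From mathcomp Require Import all_boot all_order all_algebra all_field.
From mathcomp Require Import all_classical all_reals all_analysis.
From mathcomp Require Import zify ring lra.
Import Order.TTheory GRing.Theory Num.Theory numFieldNormedType.Exports.

Local Open Scope classical_set_scope.
Local Open Scope card_scope.

(** * Cardinalities, intersecting families and containment *)

Lemma card_finType (T : finType) : [set: T] #= `I_#|T|.
Proof.
rewrite card_eq_sym; apply: (card_eq_trans card_II).
have <- : @enum_val T T @` [set: 'I_#|T|] = [set: T].
  rewrite -subTset => x _; exists (enum_rank x) => //; exact: enum_rankK.
by rewrite card_eq_sym; apply: inj_card_eq => i j _ _; apply: enum_val_inj.
Qed.

Lemma card_le1P (T : Type) (A : set T) : A #<= `I_1 -> forall x y, A x -> A y -> x = y.
Proof.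
move=> /pcard_leP/injfunPex[f fA finj] x y Ax Ay; apply: finj; rewrite ?inE //.
by move: (fA x Ax) (fA y Ay); rewrite /=; case: (f x); case: (f y).
Qed.

Lemma card_le1 (T : Type) (A : set T) : (forall x y, A x -> A y -> x = y) -> A #<= `I_1.
Proof.
move=> A1; have [->|/set0P[x Ax]] := eqVneq A set0; first exact: card_ge0.
rewrite -(card_le_eqr (@card_set1 T x)).
by apply: subset_card_le => y Ay; apply: A1.
Qed.

(** Two disjoint edges form a matching, so matching number 1 makes them equal; the edge is then
    disjoint from itself, hence empty, against uniformity [r.+1]. *)
Lemma intersecting_meet (r : nat) (H : hypergraph) e e' :
  uniform r.+1 H -> intersecting H -> edges H e -> edges H e' ->
  e `&` e' !=set0.
Proof.
move=> Hr [_ HM] He He'; apply/set0P/negP => /eqP ee'0.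
have ee' : e = e'.
  apply: (card_le1P _ [set e; e'] (HM _ _)); [split|by left|by right].
    by move=> x [->|->].
  move=> i j [->|->] [->|->] //; rewrite /= ?ee'0 ?[e' `&` e]setIC ?ee'0.
    by move=> /set0P/eqP.
  by move=> /set0P/eqP.
move: (Hr _ He); rewrite -ee' setIid in ee'0.
rewrite ee'0 card_eq_sym card_eq0 => /eqP/seteqP[+ _].
by move=> /(_ 0 isT).
Qed.

(** The sub-hypergraph can always be taken to be the family of images of the edges of [H]. *)
Lemma containedP (H H' : hypergraph) : contained H H' <->
  exists f, set_inj (non_isolated H) f /\
    forall e, edges H e -> edges H' (f @` e).
Proof.
split=> [[F FH' [f [[_ finj _] fF]]]|[f [finj fH]]].
  exists f; split=> // e He; apply: FH'.
  by rewrite /= in fF; rewrite -fF; exists e.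
exists [set f @` e | e in edges H]; first by move=> _ [e He <-]; apply: fH.
exists f; split=> //; split=> //.
  move=> x [e He ex]; exists (f @` e); first by exists e.
  by exists x.
move=> _ [_ [e He <-] [x ex <-]]; exists x => //.
by exists e.
Qed.

Lemma contained_refl H : contained H H.
Proof. by apply/containedP; exists id; split=> // e; rewrite image_id. Qed.

Lemma contained_trans H1 H2 H3 :
  contained H1 H2 -> contained H2 H3 -> contained H1 H3.
Proof.
move=> /containedP[f [finj f12]] /containedP[g [ginj g23]].
apply/containedP; exists (g \o f); split=> [x y|e He]; last first.
  by rewrite -image_comp; apply: g23; apply: f12.
have sub z : non_isolated H1 z -> f z \in non_isolated H2.
  move=> [e He ez]; rewrite inE; exists (f @` e); first exact: f12.
  by exists z.
rewrite !inE => Hx Hy /ginj gg; apply: finj; rewrite ?inE//.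
by apply: gg; apply: sub.
Qed.

Lemma ryser_class_eqP (r : nat) (H H' : hypergraph) : intersecting_ryser r H ->
  ryser_class r H = ryser_class r H' <->
  intersecting_ryser r H /\ ryser_equiv H H'.
Proof.
move=> HR; split=> [eqHH'|[_ [HH' H'H]]].
  split=> //; have : ryser_class r H H by split=> //; split; apply: contained_refl.
  by rewrite eqHH' => -[_ []].
by apply/seteqP; split=> K [KR [c1 c2]]; split=> //; split;
  apply: contained_trans c1 || apply: contained_trans c2 _.
Qed.

(** * Projective planes without a point, as Ryser hypergraphs *)

(** Encodes a projective plane of order q = [#|Q|] with a point P deleted. [I] is the set of lines
    through P, [I * Q] the remaining points, [C] the lines missing P; the lines [w] and [i] meet in
    [(i, c w i)]. *)
Definition transversal_design {I Q C : finType} (c : C -> I -> Q) :=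
  [/\ #|I| = #|Q|.+1, (1 < #|Q|)%N,
      forall i j a b, i != j ->
        #|[pred w | (c w i == a) && (c w j == b)]| = 1
    & forall w w', exists i, c w i = c w' i].

Definition design_block {I Q C : finType} (c : C -> I -> Q) (w : C) :
  set (I * Q) := [set v | c w v.1 = v.2].

Definition design_vertex {I Q : finType} (v : I * Q) : nat := pickle v.

(* The vertices are coded by natural numbers because the universe of [vertex]
   is strictly below the one of finite types such as [I * Q]. *)
Definition design_hypergraph {I Q C : finType} (c : C -> I -> Q) :=
  Hypergraph (range (fun w => design_vertex @` design_block c w)).

Lemma design_vertex_inj {I Q : finType} : injective (@design_vertex I Q).
Proof. exact: pcan_inj pickleK. Qed.

Section TransversalDesign.
Variables (I Q C : finType) (c : C -> I -> Q).
Hypothesis cD : transversal_design c.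

Lemma design_join (v v' : I * Q) : v.1 != v'.1 ->
  exists w, design_block c w v /\ design_block c w v'.
Proof.
have [_ _ /(_ v.1 v'.1 v.2 v'.2) join _] := cD; move=> /join c1.
have /card_gt0P[w] : 0 < #|[pred w | (c w v.1 == v.2) && (c w v'.1 == v'.2)]|.
  by rewrite c1.
by rewrite inE => /andP[/eqP ? /eqP ?]; exists w.
Qed.

(** Sort these codewords by their value at a second coordinate [j]: each value occurs exactly
    once. *)
Lemma design_degree i a : #|[pred w | c w i == a]| = #|Q|.
Proof.
have [cI cQ join _] := cD.
have /card_gt0P[j] : 0 < #|predC1 i| by rewrite cardC1 cI ltnW.
rewrite inE /= => ji.
rewrite -[LHS]sum1_card (partition_big (fun w => c w j) predT) //=.
rewrite -[RHS]muln1 -sum_nat_const; apply: eq_bigr => b _.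
by rewrite -[RHS](join i j a b) ?[i == j]eq_sym// -[RHS]sum1_card; apply: eq_bigl.
Qed.

Lemma design_size : #|C| = #|Q| * #|Q|.
Proof.
have [cI _ _ _] := cD.
have /card_gt0P[i _] : 0 < #|I| by rewrite cI.
rewrite -[LHS]sum1_card (partition_big (fun w => c w i) predT) //=.
rewrite -sum_nat_const; apply: eq_bigr => a _.
by rewrite -(design_degree i a) -[RHS]sum1_card.
Qed.

(* With [a w] the number of agreements of [d] with the codeword [w], double
   counting gives the sums of [a w] and of [a w ^ 2]; they are incompatible
   with [(a w - 1) * (#|Q| - a w) >= 0] for all [w]. *)
Lemma blocking_is_codeword (d : I -> option Q) :
  (forall w, exists i, d i = Some (c w i)) ->
  exists w, forall i, d i = Some (c w i).
Proof.
have [cI cQ join _] := cD => dC; set q := #|Q| in cI cQ.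
pose a w := \sum_i (d i == Some (c w i)).
apply: contrapT => /forallNP full.
have a_gt0 w : 0 < a w.
  have [i di] := dC w; rewrite /a (bigD1 i) //= di eqxx.
  exact: ltn_addr.
have a_le w : a w <= q.
  move: (full w) => /existsNP [i /eqP /negbTE di].
  have <- : #|predC1 i| = q by rewrite cardC1 cI.
  rewrite /a (bigD1 i) //= di add0n -sum1_card.
  by apply: leq_sum => j _; case: eqP.
pose t := \sum_i (d i != None : nat).
have t_le : t <= q.+1.
  by rewrite -cI -sum1_card; apply: leq_sum => i _; case: eqP.
have sum_agree i : \sum_w (d i == Some (c w i) : nat) = (d i != None) * q.
  case: (d i) => [b|]; last by rewrite big1.
  rewrite mul1n /q -(design_degree i b) -sum1_card [RHS]big_mkcond /=.
  by apply: eq_bigr => w _; rewrite inE (inj_eq Some_inj) eq_sym; case: eqP.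
have sum_agree2 i j : i != j ->
    \sum_w ((d i == Some (c w i)) * (d j == Some (c w j))) =
    (d i != None) * (d j != None).
  move=> ij; case: (d i) => [b|]; last by rewrite big1.
  case: (d j) => [b'|]; last by rewrite big1 // => w _; rewrite muln0.
  rewrite -[RHS](join i j b b' ij) -sum1_card [RHS]big_mkcond /=.
  apply: eq_bigr => w _; rewrite !(inj_eq Some_inj) eq_sym [b' == _]eq_sym.
  by rewrite inE mulnb; case: ifP.
have sum_a : \sum_w a w = t * q.
  by rewrite exchange_big /= big_distrl; apply: eq_bigr => i _.
(* A diagonal pair contributes q and an off-diagonal pair 1, wherever [d] is defined. The summand
   [t] completes the diagonal of [t * t], which avoids a subtraction. *)
have sum_a2 : \sum_w a w * a w + t = t * q + t * t.
  have -> : \sum_w a w * a w =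
      \sum_i \sum_j \sum_w ((d i == Some (c w i)) * (d j == Some (c w j))).
    under [RHS]eq_bigr => i _ do rewrite exchange_big /=.
    rewrite [RHS]exchange_big /=.
    apply: eq_bigr => w _; rewrite /a big_distrl; apply: eq_bigr => i _.
    by rewrite big_distrr.
  rewrite /t big_distrl /= [X in _ = _ + X]big_distrl -!big_split /=.
  apply: eq_bigr => i _; rewrite -/t big_distrr /= (bigD1 i) //=.
  rewrite [in RHS](bigD1 i) //= -sum_agree.
  have -> : \sum_w (d i == Some (c w i)) * (d i == Some (c w i)) =
            \sum_w (d i == Some (c w i) : nat).
    by apply: eq_bigr => w _; rewrite mulnb andbb.
  rewrite (eq_bigr (fun j => (d i != None) * (d j != None))); last first.
    by move=> j ji; rewrite sum_agree2 // eq_sym.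
  by case: (d i) => [b|] /=; lia.
have sum_ineq : \sum_w (a w * a w + q) <= \sum_w q.+1 * a w.
  by apply: leq_sum => w _; move: (a_gt0 w) (a_le w); nia.
move: sum_ineq; rewrite big_split /= sum_nat_const design_size -/q -big_distrr /=.
rewrite sum_a => sum_ineq.
have {sum_ineq sum_a2} : t * q + t * t + q * q * q <= q.+1 * (t * q) + t.
  by rewrite -sum_a2 addnAC leq_add2r.
(* For t = q + 1 the inequality reduces to q <= 0. For q = t + s it becomes q^2 s + t^2 <= t,
   impossible as q > 1. *)
move: t_le; rewrite leq_eqVlt ltnS => /orP[/eqP -> | /subnKC]; first by nia.
move: (q - t) => s tq; rewrite -tq in cQ *.
move=> h; have {h} : (t + s) * (t + s) * s + t * t <= t by nia.
by move: cQ; case: s {tq} => [|s]; nia.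
Qed.

Lemma uniform_design : uniform #|I| (design_hypergraph c).
Proof.
move=> _ [w _ <-].
have -> : design_block c w = (fun i => (i, c w i)) @` [set: I].
  apply/seteqP; split=> [[i a] ia|_ [i _ <-] //].
  by exists i => //; rewrite (ia : c w i = a).
rewrite image_comp; apply: card_eq_trans (card_finType I).
by apply: inj_card_eq => i j _ _ /design_vertex_inj[].
Qed.

Lemma partite_design : partite #|I| (design_hypergraph c).
Proof.
have [cI cQ _ _] := cD.
have /card_gt0P[i0 _] : 0 < #|I| by rewrite cI.
(* Numbers that code no vertex lie on no edge and get the arbitrary side [i0]. *)
exists (fun x => enum_rank (if unpickle x is Some v then (v : I * Q).1 else i0)).
move=> _ [w _ <-] _ _ [[i a] ia <-] [[j b] jb <-].
rewrite -(ia : c w i = a) -(jb : c w j = b).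
by rewrite !pickleK => /enum_rank_inj /= ->.
Qed.

Lemma intersecting_design : intersecting (design_hypergraph c).
Proof.
have [cI cQ _ meet] := cD.
have /card_gt0P[w0 _] : 0 < #|C| by rewrite design_size; nia.
split.
  exists [set design_vertex @` design_block c w0]; split; last exact: card_set1.
  split; first by move=> _ ->; exists w0.
  by move=> e e' -> ->.
move=> M [Msub Mtriv]; apply: card_le1 => x y Mx My; apply: Mtriv => //.
have [[w _ <-] [w' _ <-]] := (Msub x Mx, Msub y My).
have [i ci] := meet w w'.
by exists (design_vertex (i, c w i)); split; exists (i, c w i).
Qed.

(** Every codeword has a value at a given coordinate, so one side is a cover. Conversely a vertex
    lies on q of the q^2 blocks, so at least q vertices are needed. *)
Lemma cover_number_design : cover_number (design_hypergraph c) #|Q|.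
Proof.
have [cI cQ _ meet] := cD.
have /card_gt0P[i _] : 0 < #|I| by rewrite cI.
split.
  exists ((fun a => design_vertex (i, a)) @` [set: Q]); split.
    move=> _ [w _ <-]; exists (design_vertex (i, c w i)); split.
      by exists (c w i).
    by exists (i, c w i).
  apply: card_eq_trans (card_finType Q).
  by apply: inj_card_eq => a b _ _ /design_vertex_inj[].
(* Only the members of [K] that code vertices are counted, so [K] may be infinite. *)
move=> K Kcov; pose B : pred (I * Q) := fun v => `[< K (design_vertex v) >].
have cB : #|Q| <= #|B|.
  rewrite -(leq_pmul2l (ltnW cQ)) -design_size -sum1_card.
  apply: (@leq_trans (\sum_w \sum_(v in B) (c w v.1 == v.2 : nat))).
    apply: leq_sum => w _.
    have [|x [Kx [v wv vx]]] := Kcov (design_vertex @` design_block c w).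
      by exists w.
    rewrite (bigD1 v) /=; last by apply/asboolP; rewrite vx.
    by rewrite wv eqxx.
  rewrite exchange_big /= mulnC -sum_nat_const; apply: leq_sum => v _.
  rewrite -(design_degree v.1 v.2) -sum1_card [leqRHS]big_mkcond /=.
  by apply: leq_sum => w _; rewrite inE; case: eqP.
apply: (@card_le_trans _ _ _ `I_#|B|); first by rewrite card_le_II.
pose h (i : 'I_#|B|) := design_vertex (@enum_val _ B i).
have hinj : injective h by move=> j k /design_vertex_inj/enum_val_inj.
rewrite (card_le_eql card_II) -(card_le_eql (inj_card_eq (in2W hinj))).
apply: subset_card_le => _ [x _ <-].
by have /asboolP := enum_valP x.
Qed.

Lemma ryser_design : intersecting_ryser #|I| (design_hypergraph c).
Proof.
split.
- exact/finite_set_countable/finite_image/finite_finset.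
- exact: uniform_design.
- exact: partite_design.
- exact: intersecting_design.
- by have [-> _ _ _] := cD; exists #|Q| => //; exact: cover_number_design.
Qed.

(* The sides of [H] are forced on the image of the design, so an edge of [H]
   restricts to a partial transversal meeting all the codewords. *)
Lemma design_saturated (H : hypergraph) f :
  intersecting_ryser #|I| H -> injective f ->
  (forall w, edges H (f @` design_block c w)) ->
  forall e, edges H e -> exists w, e = f @` design_block c w.
Proof.
have [cI cQ _ meet] := cD => -[_ Hr [side sideP] Hint _] finj fC e He.
pose g v := side (f v).
have gneq v v' : v.1 != v'.1 -> g v != g v'.
  move=> vv'; have [w [wv wv']] := design_join v v' vv'.
  apply/eqP => gvv'; have /finj evv' : f v = f v'.
    by apply: (sideP _ (fC w)) gvv'; [exists v|exists v'].
  by rewrite evv' eqxx in vv'.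
(* The q + 1 points of a block lie on distinct sides, hence on all sides. *)
have gsurj w s : exists k, g (k, c w k) = s.
  have ginj : injective (fun k => g (k, c w k)).
    move=> k l; have [//|kl] := eqVneq k l.
    by move=> /eqP; rewrite (negbTE (gneq (k, _) (l, _) kl)).
  have /codomP[k ->] : s \in codom (fun k => g (k, c w k)).
    by apply: inj_card_onto => //; rewrite card_ord.
  by exists k.
(* A block through [(i, b)] has a point on the side of [(i, a)]. Its coordinate must be [i], since
   points with different coordinates lie on different sides, so it is [(i, b)]. *)
have gside i a b : g (i, a) = g (i, b).
  have /card_gt0P[w] : 0 < #|[pred w | c w i == b]|.
    by rewrite design_degree ltnW.
  rewrite inE => /eqP wb; have [k gk] := gsurj w (g (i, a)).
  have [ik|ki] := eqVneq k i; first by rewrite -gk ik wb.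
  by move/eqP: gk; rewrite (negbTE (gneq (k, _) (i, _) ki)).
pose d i := [pick a | `[< e (f (i, a)) >]].
have dP i a : e (f (i, a)) -> d i = Some a.
  move=> ea; rewrite /d; case: pickP => [b /asboolP eb|/(_ a)/asboolP//].
  congr Some; suff /finj [] : f (i, b) = f (i, a) by [].
  by apply: (sideP _ He) => //; apply: gside.
have [w|w wd] := blocking_is_codeword d.
  have := fC w; rewrite cI in Hr; move=> /(intersecting_meet _ _ _ _ Hr Hint He).
  move=> [_ [/[swap] -[[i a] wa <-] /dP]].
  by exists i; rewrite (wa : c w i = a).
have ew k : e (f (k, c w k)).
  have := wd k; rewrite /d; case: pickP => // a /asboolP ea [<-].
  exact: ea.
exists w; apply/seteqP; split=> [x ex|_ [[k a] ka <-]]; last by rewrite -(ka : c w k = a).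
(* Even if [x] were outside the image of [f], it shares its side with a point of the block; that
   point lies in [e], so the two coincide. *)
have [k gk] := gsurj w (side x).
exists (k, c w k) => //; exact: (sideP _ He).
Qed.

Lemma contained_design (H : hypergraph) : contained (design_hypergraph c) H ->
  exists f, injective (f \o design_vertex : I * Q -> vertex H) /\
    forall w, edges H ((f \o design_vertex) @` design_block c w).
Proof.
have [cI cQ _ _] := cD.
move=> /containedP[f [finj fH]]; exists f; split; last first.
  by move=> w; rewrite -image_comp; apply: fH; exists w.
have iso (v : I * Q) : design_vertex v \in non_isolated (design_hypergraph c).
  case: v => i a; have /card_gt0P[w] : 0 < #|[pred w | c w i == a]|.
    by rewrite design_degree ltnW.
  rewrite !inE => /eqP wa; exists (design_vertex @` design_block c w); first by exists w.
  by exists (i, a).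
by move=> v v' /finj fvv'; apply: design_vertex_inj; apply: fvv'.
Qed.

(** By saturation every edge of [H] is the image of a block, so a left inverse of the embedding
    carries [H] back into the design. *)
Lemma design_contained_sym (H : hypergraph) :
  intersecting_ryser #|I| H -> contained (design_hypergraph c) H ->
  contained H (design_hypergraph c).
Proof.
have [cI cQ _ _] := cD.
have /card_gt0P[i0 _] : 0 < #|I| by rewrite cI.
have /card_gt0P[a0 _] : 0 < #|Q| by rewrite ltnW.
move=> HR /contained_design[f [finj fH]].
pose g y := xget (i0, a0) [set v | f (design_vertex v) = y].
have fK v : g (f (design_vertex v)) = v.
  by rewrite /g; case: xgetP => [u -> /finj|/(_ v)/(_ erefl)].
have gE := design_saturated _ _ HR finj fH.
apply/containedP; exists (design_vertex \o g); split=> [x y|e /gE[w ->]]; last first.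
  by exists w => //; rewrite image_comp; apply: eq_imagel => v _; rewrite /= fK.
rewrite !inE => -[_ /gE[w ->] [v _ <-]] [_ /gE[w' ->] [v' _ <-]].
by rewrite /= !fK => /design_vertex_inj ->.
Qed.

Lemma design_maximal :
  ryser_maximal #|I| (ryser_class #|I| (design_hypergraph c)).
Proof.
split=> [|_ [H HR <-] [H1 [H2 [[H1R [D1 _]] [H2R [HH2 H2H]] H12]]]].
  by exists (design_hypergraph c) => //; exact: ryser_design.
have DH2 := contained_trans _ _ _ D1 H12.
have H2D := design_contained_sym _ H2R DH2.
apply/ryser_class_eqP => //; split=> //; split.
  exact: contained_trans HH2 H2D.
exact: contained_trans DH2 H2H.
Qed.

End TransversalDesign.

(** * Isomorphisms of transversal designs *)

(** Between transversal designs on the same finite vertex set this is an isomorphism, since both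
    have q^2 blocks. *)
Definition design_map {I Q C C' : finType} (c : C -> I -> Q) (c' : C' -> I -> Q)
    (h : I * Q -> I * Q) :=
  injective h /\ forall w, exists w', h @` design_block c w = design_block c' w'.

Lemma design_block_inj {I Q C : finType} (c : C -> I -> Q) w w' :
  design_block c w = design_block c w' -> forall i, c w i = c w' i.
Proof.
move=> ww' i; have : design_block c w (i, c w i) by [].
by rewrite ww' => /esym.
Qed.

Lemma image_set_inj {T U : Type} {f : T -> U} :
  injective f -> injective (fun A : set T => f @` A).
Proof.
move=> finj A B fAB; apply/funext => x.
by rewrite -[LHS](image_inj finj) fAB (image_inj finj).
Qed.

Section DesignMap.
Variables (I Q C C' : finType) (c : C -> I -> Q) (c' : C' -> I -> Q).
Hypotheses (cD : transversal_design c) (cD' : transversal_design c').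

Lemma design_code_inj w w' : (forall i, c w i = c w' i) -> w = w'.
Proof.
have [cI cQ join _] := cD => cww'.
have /card_gt1P[i [j [_ _ ij]]] : 1 < #|I| by rewrite cI ltnW.
have [w0 w0P] := mem_card1 (join i j (c w i) (c w j) ij).
have := w0P w; have := w0P w'.
by rewrite !inE -!cww' !eqxx => /esym/eqP-> /esym/eqP->.
Qed.

Lemma design_map_codeword h : design_map c c' h ->
  exists phi : C -> C', bijective phi /\
    forall w, h @` design_block c w = design_block c' (phi w).
Proof.
move=> [hinj /choice[phi hphi]]; exists phi; split=> //.
apply: inj_card_bij => [w w' eqw|]; last by rewrite !(design_size _ _ _ _ cD, design_size _ _ _ _ cD').
apply: design_code_inj; apply: design_block_inj.
by apply: (image_set_inj hinj); rewrite hphi eqw hphi.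
Qed.

Lemma design_map_inv h g : design_map c c' h -> cancel h g -> design_map c' c g.
Proof.
move=> ch hK; have gK := canF_sym hK.
have [phi [[psi _ psiK] hphi]] := design_map_codeword _ ch.
split=> [|w']; first exact: can_inj gK.
exists (psi w'); rewrite -{1}[w']psiK -hphi image_comp -[RHS]image_id.
by apply: eq_imagel => v _; rewrite /= hK.
Qed.

(** Distinct vertices lie on a common block exactly when their sides differ, so a map of designs
    respects the sides. *)
Lemma design_map_side h : design_map c c' h ->
  exists (pi : I -> I) (phi : C -> C'), injective pi /\
    forall w i, h (i, c w i) = (pi i, c' (phi w) (pi i)).
Proof.
have [_ cQ _ _] := cD => ch; have hinj := ch.1.
have [phi [[psi _ psiK] hphi]] := design_map_codeword _ ch.
have hblock w i : c' (phi w) (h (i, c w i)).1 = (h (i, c w i)).2.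
  have : (h @` design_block c w) (h (i, c w i)) by exists (i, c w i).
  by rewrite hphi.
have side i a b : (h (i, a)).1 = (h (i, b)).1.
  have [//|neq] := eqVneq (h (i, a)).1 (h (i, b)).1.
  have [w' []] := design_join _ _ _ _ cD' _ _ neq.
  rewrite -[w']psiK -hphi => -[va wa /hinj hva] [vb wb /hinj hvb].
  rewrite hva in wa; rewrite hvb in wb.
  by rewrite -(wa : c _ i = a) -(wb : c _ i = b).
have /card_gt0P[a0 _] : 0 < #|Q| by exact: ltnW.
exists (fun i => (h (i, a0)).1), phi; split.
  move=> i j hij; apply/eqP/negP => /negP ij.
  have [w [wi wj]] := design_join _ _ _ _ cD (i, a0) (j, a0) ij.
  have hi := hblock w i; have hj := hblock w j.
  rewrite (wi : c w i = a0) in hi; rewrite (wj : c w j = a0) in hj.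
  have [ij'] : (i, a0) = (j, a0).
    by apply: hinj; rewrite [LHS]surjective_pairing -hi hij hj -surjective_pairing.
  by rewrite ij' eqxx in ij.
move=> w i; rewrite -(side _ (c w i)) hblock.
exact: surjective_pairing.
Qed.

End DesignMap.

Lemma design_class_map {I Q C C' : finType} (c : C -> I -> Q) (c' : C' -> I -> Q) :
  transversal_design c -> transversal_design c' ->
  ryser_class #|I| (design_hypergraph c) = ryser_class #|I| (design_hypergraph c') ->
  exists h, design_map c c' h.
Proof.
move=> cD cD'.
have /ryser_class_eqP cP := ryser_design _ _ _ _ cD.
move=> /cP[_ [/(contained_design _ _ _ _ cD)[f [finj fE]] _]].
(* The default [v] is never taken: every vertex is on a block, whose image is an edge and so
   consists of codes. *)
pose h (v : I * Q) := odflt v (unpickle (f (design_vertex v))).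
have hE v : design_vertex (h v) = f (design_vertex v).
  have [_ cQ _ _] := cD.
  have /card_gt0P[w] : 0 < #|[pred w | c w v.1 == v.2]|.
    by rewrite (design_degree _ _ _ _ cD) ltnW.
  rewrite inE => /eqP wv; have [w' _ w'E] := fE w.
  have : ((f \o design_vertex) @` design_block c w) (f (design_vertex v)).
    by exists v.
  by rewrite -w'E => -[u _ uv]; rewrite /h -uv /design_vertex pickleK.
exists h; split=> [v v' hv|w].
  by apply: finj; rewrite /= -!hE hv.
have [w' _ w'E] := fE w; exists w'.
apply: (image_set_inj (@design_vertex_inj I Q)).
by rewrite w'E image_comp; apply: eq_imagel => v _; rewrite /= hE.
Qed.

(** * Andre planes of order p^2 and their rigidity *)

Section AndrePlane.
Variables (F : finFieldType) (p : nat).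
Hypotheses (charF : p \in [pchar F]%R) (cardF : #|F| = p ^ 2).

Local Open Scope ring_scope.

Let p_pr : prime p := pcharf_prime charF.

(** The norm of [F] over its prime field: the product of [x] and its conjugate [x ^+ p]. *)
Definition andre_norm (x : F) := x ^+ p.+1.

(** Multiplication of the Andre quasifield of [S]; the first argument is the slope. *)
Definition andre_mul (S : {set F}) (m x : F) :=
  if andre_norm m \in S then x ^+ p * m else x * m.

(** The deleted point is the one at infinity on the vertical lines. Side [Some x] is the vertical
    line at [x], side [None] the line at infinity with the slopes as points, and [(m, b)] the line
    of slope [m] and intercept [b]. *)
Definition andre_code (S : {set F}) (w : F * F) (i : option F) :=
  if i is Some x then andre_mul S w.1 x + w.2 else w.1.

Definition andre_norms : {set F} := [set andre_norm x | x in predC1 0].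

Implicit Types (S : {set F}) (m x y z : F).

Lemma frobB x y : (x - y) ^+ p = x ^+ p - y ^+ p.
Proof. by rewrite -!(pFrobenius_autE charF) pFrobenius_autB_comm //; apply: mulrC. Qed.

Lemma frobK x : (x ^+ p) ^+ p = x.
Proof. by rewrite -exprM mulnn -cardF expf_card. Qed.

Lemma andre_normM x y : andre_norm (x * y) = andre_norm x * andre_norm y.
Proof. exact: exprMn. Qed.

Lemma andre_norm_frob x : andre_norm (x ^+ p) = andre_norm x.
Proof. by rewrite /andre_norm exprS frobK -exprSr. Qed.

Lemma andre_norm_eq0 x : (andre_norm x == 0) = (x == 0).
Proof. exact: expf_eq0. Qed.

Lemma andre_norm_mul S m x : andre_norm (andre_mul S m x) = andre_norm x * andre_norm m.
Proof. by rewrite /andre_mul; case: ifP; rewrite andre_normM ?andre_norm_frob. Qed.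

Lemma andre_mul0l S x : andre_mul S 0 x = 0.
Proof. by rewrite /andre_mul; case: ifP; rewrite mulr0. Qed.

Lemma andre_mul0r S m : andre_mul S m 0 = 0.
Proof. by rewrite /andre_mul expr0n gtn_eqF ?prime_gt0 // !mul0r if_same. Qed.

Lemma andre_mul1r S m : andre_mul S m 1 = m.
Proof. by rewrite /andre_mul expr1n mul1r if_same. Qed.

Lemma andre_mulBr S m x y : andre_mul S m (x - y) = andre_mul S m x - andre_mul S m y.
Proof. by rewrite /andre_mul; case: ifP; rewrite ?frobB mulrBl. Qed.

(* Comparing norms shows that [m] and [m'] fall in the same case. *)
Lemma andre_mul_injl S x m m' : x != 0 ->
  andre_mul S m x = andre_mul S m' x -> m = m'.
Proof.
move=> x0 mm'; have norm_mm' : andre_norm m = andre_norm m'.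
  apply: (mulfI (_ : andre_norm x != 0)); first by rewrite andre_norm_eq0.
  by rewrite -!(andre_norm_mul S) mm'.
move: mm'; rewrite /andre_mul norm_mm'; case: ifP => _; apply: mulfI => //.
exact: expf_neq0.
Qed.

(** Additivity in [x] turns a collision into [andre_mul S m (x - y) = andre_mul S m' (x - y)], where
    [x - y] can be cancelled unless it is 0. This makes lines of different slopes meet. *)
Lemma andre_mul_diff_inj S m m' : m != m' ->
  injective (fun x => andre_mul S m x - andre_mul S m' x).
Proof.
move=> mm' x y xy.
have {}xy : andre_mul S m (x - y) = andre_mul S m' (x - y).
  by rewrite !andre_mulBr -[andre_mul S m x](subrK (andre_mul S m' x)) xy; ring.
apply/eqP; rewrite -subr_eq0; apply/negPn/negP => /andre_mul_injl/(_ xy)/eqP.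
by rewrite (negbTE mm').
Qed.

Lemma andre_design S : transversal_design (andre_code S).
Proof.
have F_gt1 : (1 < #|F|)%N by rewrite cardF (ltn_exp2l 0) // prime_gt1.
have card1 (P : pred (F * F)) w : (forall w', P w' = (w' == w)) -> #|[pred w | P w]| = 1%N.
  by move=> Pw; rewrite -(card1 w); apply: eq_card.
split=> //; first by rewrite card_option.
- have joinN x a b : #|[pred w | (andre_code S w None == a) && (andre_code S w (Some x) == b)]| = 1%N.
    apply: (card1 _ (a, b - andre_mul S a x)) => -[m d] /=.
    rewrite xpair_eqE; apply: andb_id2l => /eqP->.
    by rewrite [RHS]eq_sym subr_eq addrC eq_sym.
  move=> [x|] [y|] a b //.
  + move=> xy; have {}xy : x - y != 0 by rewrite subr_eq0.
    (* The slope of the line through [(x, a)] and [(y, b)] solves [andre_mul S m (x - y) = a - b];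
       injectivity on a finite field provides the inverse [g]. *)
    have [g gK Kg] := injF_bij (fun m m' => andre_mul_injl S (x - y) m m' xy).
    apply: (card1 _ (g (a - b), a - andre_mul S (g (a - b)) x)) => -[m d] /=.
    rewrite xpair_eqE; apply/andP/andP => -[/eqP xa /eqP yb].
      have -> : a - b = andre_mul S m (x - y) by rewrite andre_mulBr -xa -yb; ring.
      by rewrite gK -xa addrAC subrr add0r !eqxx.
    rewrite xa yb; set G := g _; have e : andre_mul S G x - andre_mul S G y = a - b.
      by rewrite -andre_mulBr; exact: Kg.
    by split; apply/eqP; [ring|rewrite -[RHS](subKr a) -e; ring].
  + by rewrite -(joinN x b a) => _; apply: eq_card => w; rewrite !inE andbC.
move=> [m b] [m' b'].
(* Parallel lines meet at infinity. *)
have [->|mm'] := eqVneq m m'; first by exists None.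
have [g _ gK] := injF_bij (andre_mul_diff_inj S _ _ mm').
exists (Some (g (b' - b))) => /=; set x := g _.
by rewrite -[andre_mul S m x](subrK (andre_mul S m' x)) (gK (b' - b)); ring.
Qed.

Lemma natr_pchar_inj (a b : nat) : (a < p)%N -> (b < p)%N -> a%:R = b%:R :> F -> a = b.
Proof.
wlog ab : a b / (a <= b)%N => [H ap bp abR|].
  by case/orP: (leq_total a b) => ab; [apply: H|apply/esym/H].
move=> _ bp abR; apply/eqP; rewrite eqn_leq ab -subn_eq0 /=.
have : (p %| b - a)%N by rewrite (dvdn_pcharf charF) natrB // abR subrr.
by move=> /dvdn_leq; case: (b - a)%N (leq_subr a b) => // n nb /(_ isT); lia.
Qed.

Section Rigidity.
Variable theta : F.
Hypothesis theta_frob : theta ^+ p != theta.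

(** 1 and [theta] are a basis over the prime field. Subtracting an element from its p-th power kills
    the multiple of 1, which gives independence; the p^2 combinations then exhaust [F]. *)
Lemma span_theta z : exists a b : nat, z = 1 *+ a + theta *+ b.
Proof.
pose f (u : 'I_p * 'I_p) : F := 1 *+ u.1 + theta *+ u.2.
have finj : injective f.
  move=> [a b] [a' b']; rewrite /f /= => ff'.
  have frobf c d : (1 *+ c + theta *+ d) ^+ p = 1 *+ c + theta ^+ p *+ d :> F.
    by rewrite -!(pFrobenius_autE charF) rmorphD !rmorphMn rmorph1.
  have bb' : b = b'.
    have bb'R : (theta ^+ p - theta) * b%:R = (theta ^+ p - theta) * b'%:R.
      have diff c d : (1 *+ c + theta *+ d) ^+ p - (1 *+ c + theta *+ d) =
          (theta ^+ p - theta) * d%:R.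
        by rewrite frobf mulrBl !mulr_natr opprD addrACA subrr add0r.
      by rewrite -(diff a) ff' diff.
    apply/val_inj/natr_pchar_inj; rewrite ?ltn_ord //.
    by apply: (mulfI _ bb'R); rewrite subr_eq0.
  rewrite -bb' in ff' *; congr (_, _).
  by apply/val_inj/natr_pchar_inj; rewrite ?ltn_ord //; apply: addIr ff'.
have [|g _ gK] := inj_card_bij finj.
  by rewrite card_prod card_ord cardF mulnn.
by exists (g z).1, (g z).2; rewrite -[LHS]gK.
Qed.

Lemma additive_theta (E : F -> F) : (forall x y, E (x + y) = E x + E y) ->
  E 1 = 1 -> E theta = theta -> forall z, E z = z.
Proof.
move=> ED E1 Et; have E0 : E 0 = 0 by apply: (addrI (E 0)); rewrite -ED !addr0.
have EMn u n : E (u *+ n) = E u *+ n.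
  by elim: n => [|n IH]; rewrite ?mulr0n // !mulrS ED IH.
by move=> z; have [a [b ->]] := span_theta z; rewrite ED !EMn E1 Et.
Qed.

(** One map [E] describes the action on slopes, intercepts and ordinates. Side [Some 1] makes it
    additive, and the last two fixed vertices make it the identity. On side [Some theta] the two
    multiplications then agree at [theta], and as [theta ^+ p != theta] this tells whether the norm
    of [m] lies in each set. *)
Lemma andre_rigid S S' h : S \subset andre_norms -> S' \subset andre_norms ->
  design_map (andre_code S) (andre_code S') h ->
  h (None, 0) = (None, 0) -> h (Some 0, 0) = (Some 0, 0) ->
  h (Some 1, 1) = (Some 1, 1) -> h (Some theta, theta) = (Some theta, theta) ->
  S = S'.
Proof.
move=> SN SN' hD hN h0 h1 ht.
have [pi [phi [pi_inj hE]]] := design_map_side _ _ _ _ _ _ (andre_design S) (andre_design S') _ hD.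
have piE i a : pi i = (h (i, a)).1.
  case: i => [x|]; last by have := hE (a, 0) None => /= ->.
  by have := hE (0, a) (Some x); rewrite /= andre_mul0l add0r => ->.
have piN : pi None = None by rewrite (piE _ 0) hN.
have pi0 : pi (Some 0) = Some 0 by rewrite (piE _ 0) h0.
have pi1 : pi (Some 1) = Some 1 by rewrite (piE _ 1) h1.
have pit : pi (Some theta) = Some theta by rewrite (piE _ theta) ht.
(* [nu] acts on slopes, [beta m] on the intercepts of the lines of slope [m]. *)
pose nu m := (h (None, m)).2.
pose beta m b := (phi (m, b)).2.
have phi1 m b : (phi (m, b)).1 = nu m.
  by have := hE (m, b) None; rewrite /nu piN /= => ->.
have nu0 : nu 0 = 0 by rewrite /nu hN.
have eta x x' m b : pi (Some x) = Some x' ->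
    (h (Some x, andre_mul S m x + b)).2 = andre_mul S' (nu m) x' + beta m b.
  by move=> px; have := hE (m, b) (Some x); rewrite px /= phi1 => ->.
(* Horizontal lines go to horizontal lines, so the ordinates on these sides all undergo the same
   map. *)
have eta0 x x' b : pi (Some x) = Some x' -> (h (Some x, b)).2 = beta 0 b.
  by move=> /(eta _ _ 0 b); rewrite nu0 !andre_mul0l !add0r.
(* On side [Some 0] the ordinate of a line is its intercept, whatever the slope. *)
have beta0 m b : beta m b = beta 0 b.
  by have := eta _ _ m b pi0; rewrite !andre_mul0r !add0r (eta0 _ _ _ pi0).
pose E := beta 0.
have EE x x' m b : pi (Some x) = Some x' ->
    E (andre_mul S m x + b) = andre_mul S' (nu m) x' + E b.
  by move=> px; rewrite /E -(beta0 m b) -(eta _ _ _ _ px) (eta0 _ _ _ px).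
have E0 : E 0 = 0 by rewrite /E -(eta0 _ _ _ pi0) h0.
have nuE m : E m = nu m.
  by have := EE _ _ m 0 pi1; rewrite !andre_mul1r E0 !addr0.
have Eid : forall z, E z = z.
  apply: additive_theta.
  - by move=> x y; have := EE _ _ x y pi1; rewrite !andre_mul1r -nuE.
  - by rewrite /E -(eta0 _ _ _ pi1) h1.
  - by rewrite /E -(eta0 _ _ _ pit) ht.
have mulE m : andre_mul S m theta = andre_mul S' m theta.
  by have := EE _ _ m 0 pit; rewrite -nuE !Eid !addr0.
have inN m : m != 0 -> (andre_norm m \in S) = (andre_norm m \in S').
  move=> m0; have := mulE m; rewrite /andre_mul.
  by case: ifP; case: ifP => // _ _ /(mulIf m0)/eqP; rewrite ?[theta == _]eq_sym (negbTE theta_frob).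
apply/setP => z; have [/imsetP[m m0 ->]|zN] := boolP (z \in andre_norms).
  exact: inN.
by rewrite (contraNF (fintype.subsetP SN z) zN) (contraNF (fintype.subsetP SN' z) zN).
Qed.

(** Each [S] is keyed by the preimages of the four vertices of [andre_rigid]. If two sets share a
    key, one map composed with the inverse of the other fixes these vertices, so the sets are
    equal. *)
Lemma card_andre_class S0 : S0 \subset andre_norms ->
  (#|[set S in powerset andre_norms | `[<exists h, design_map (andre_code S0) (andre_code S) h>]]%SET|
    <= (#|{: option F * F}|) ^ 4)%N.
Proof.
move=> S0N; set A := [set S in _ | _]%SET.
pose mp S : option F * F -> option F * F :=
  match pselect (exists h, design_map (andre_code S0) (andre_code S) h) with
  | left ex => projT1 (cid ex) | right _ => id end.
have mpP S : S \in A -> design_map (andre_code S0) (andre_code S) (mp S).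
  rewrite inE /mp => /andP[_ /asboolP ex]; case: pselect => // ex'.
  exact: projT2 (cid _).
have mpK S : S \in A -> exists g, cancel (mp S) g /\ cancel g (mp S).
  by move=> /mpP[/injF_bij[g gK Kg] _]; exists g.
have inv S v : exists u, S \in A -> mp S u = v.
  have [SA|] := boolP (S \in A); last by exists v.
  by have [g [_ gK]] := mpK S SA; exists (g v).
pose key S (v : option F * F) := projT1 (cid (inv S v)).
have keyP S v : S \in A -> mp S (key S v) = v by exact: projT2 (cid (inv S v)).
pose K S := (key S (None, 0), key S (Some 0, 0), key S (Some 1, 1), key S (Some theta, theta)).
have -> : (#|{: option F * F}| ^ 4)%N =
    #|{: (option F * F) * (option F * F) * (option F * F) * (option F * F)}|.
  by rewrite !card_prod !expnS expn0 muln1 !mulnA.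
rewrite -(card_in_imset (f := K)) ?max_card // => S S' SA SA' [k1 k2 k3 k4].
have [g [gK _]] := mpK S SA.
have gv v : g v = key S v by rewrite -{1}(keyP S v SA) gK.
have [[S0D1 hD1] [hinj' hD']] := (mpP _ SA, mpP _ SA').
apply: (andre_rigid _ _ (mp S' \o g)).
- by move: SA; rewrite inE powersetE => /andP[].
- by move: SA'; rewrite inE powersetE => /andP[].
- have [ginj gD] := design_map_inv _ _ _ _ _ _ (andre_design S0) (andre_design S) _ _ (mpP _ SA) gK.
  split=> [|w]; first exact: inj_comp.
  have [w' gw] := gD w; have [w'' hw] := hD' w'.
  by exists w''; rewrite -image_comp gw.
- by rewrite /= gv k1 keyP.
- by rewrite /= gv k2 keyP.
- by rewrite /= gv k3 keyP.
- by rewrite /= gv k4 keyP.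
Qed.

End Rigidity.

(** X^p - X has at most p roots among the p^2 elements of [F]. *)
Lemma exists_theta : exists theta : F, theta ^+ p != theta.
Proof.
apply/existsP; rewrite -negb_forall; apply/negP => /forallP allF.
have p_gt1 := prime_gt1 p_pr.
pose P : {poly F} := 'X^p - 'X.
have sP : size P = p.+1.
  by rewrite size_polyDl ?size_polyXn // size_polyN size_polyX.
have P0 : P != 0 by rewrite -size_poly_eq0 sP.
have Proot : all (root P) (enum F).
  by apply/allP => x _; rewrite rootE !hornerE (eqP (allF x)) subrr.
have := max_poly_roots P0 Proot (enum_uniq F).
by rewrite sP -cardE cardF; nia.
Qed.

(** Each norm c has at most p + 1 preimages, the roots of X^(p+1) - c, and there are p^2 - 1 = (p -
    1)(p + 1) nonzero elements. *)
Lemma card_andre_norms : (p.-1 <= #|andre_norms|)%N.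
Proof.
have p_gt1 := prime_gt1 p_pr.
have : (#|predC1 (0%R : F)| <= #|andre_norms| * p.+1)%N.
  rewrite -[leqLHS]sum1_card (partition_big andre_norm (mem andre_norms)) /=; last first.
    by move=> x x0; apply: imset_f.
  rewrite -sum_nat_const; apply: leq_sum => c _.
  pose P : {poly F} := 'X^(p.+1) - c%:P.
  have sP : size P = p.+2 by rewrite size_XnsubC.
  have P0 : P != 0 by rewrite -size_poly_eq0 sP.
  pose A := [pred x in predC1 (0 : F) | andre_norm x == c].
  rewrite (sum1_card A).
  have Proot : all (root P) (enum A).
    apply/allP => x; rewrite mem_enum inE => /andP[_ /eqP xc].
    by rewrite rootE !hornerE -xc subrr.
  have := max_poly_roots P0 Proot (enum_uniq A).
  by rewrite sP -cardE.
rewrite cardC1 cardF => le_norms.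
by rewrite -(leq_pmul2r (ltn0Sn p)); apply: leq_trans le_norms; nia.
Qed.

End AndrePlane.

(** * Counting distinct maximal classes *)

(** [rho] picks one representative per fibre of [f]; each representative accounts for at most [b]
    elements of [A]. *)
Lemma injective_on_subset {T : finType} {U : Type} (f : T -> U) (A : {set T}) (b : nat) :
  (forall x, x \in A -> #|[set y in A | `[< f x = f y >]]%SET| <= b) ->
  exists B : {set T}, [/\ B \subset A, {in B &, injective f} & #|A| <= #|B| * b].
Proof.
move=> fib; pose rho x := odflt x [pick y in A | `[< f x = f y >]].
have rhoP x : x \in A -> rho x \in A /\ f x = f (rho x).
  rewrite /rho; case: pickP => //= y /andP[yA /asboolP fy] _; by [].
have rho_eq x y : x \in A -> f x = f y -> rho x = rho y.
  move=> xA fxy; rewrite /rho fxy; case: pickP => //= /(_ x).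
  by rewrite xA /= asboolT.
exists (rho @: A)%SET; split.
- by apply/fintype.subsetP => _ /imsetP[x /rhoP[? _] ->].
- move=> _ _ /imsetP[x xA ->] /imsetP[y yA ->].
  have [[_ fx] [_ fy]] := (rhoP x xA, rhoP y yA).
  by rewrite -fx -fy; exact: rho_eq.
rewrite -[leqLHS]sum1_card (partition_big rho (mem (rho @: A)%SET)) /=; last first.
  by move=> x; exact: imset_f.
rewrite -sum_nat_const; apply: leq_sum => _ /imsetP[x /rhoP[xA fx] ->].
apply: leq_trans (fib _ xA); rewrite -[leqRHS]sum1_card.
rewrite big_mkcond [leqRHS]big_mkcond /=; apply: leq_sum => y _.
case: ifP => // /andP[yA /eqP <-]; rewrite inE yA; case: asboolP => // -[].
by have [_ ->] := rhoP y yA.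
Qed.

Lemma many_ryser_maximal (p : nat) : prime p -> exists k,
  2 ^ p.-1 <= k * ((p ^ 2).+1 * p ^ 2) ^ 4 /\ `I_k #<= ryser_maximal (p ^ 2).+1.
Proof.
move=> p_pr; have [F charF cardF] := pPrimePowerField p_pr (isT : 0 < 2).
have [theta theta_frob] := exists_theta F p charF cardF.
pose D S := design_hypergraph (andre_code F p S).
have DD := andre_design F p charF cardF.
have rE : #|{: option F}| = (p ^ 2).+1 by rewrite card_option cardF.
pose f S := ryser_class (p ^ 2).+1 (D S).
have [S SN|B [BN finj Bcard]] :=
    injective_on_subset f (powerset (andre_norms F p)) (((p ^ 2).+1 * p ^ 2) ^ 4).
  rewrite powersetE in SN; rewrite -{1}cardF -cardF.
  apply: leq_trans (_ : _ <= #|{: option F * F}| ^ 4) _; last first.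
    by rewrite card_prod rE cardF.
  apply: leq_trans (card_andre_class _ _ charF cardF _ theta_frob _ SN).
  apply: subset_leq_card; apply/fintype.subsetP => S'; rewrite !inE => /andP[-> /=].
  move=> /asboolP; rewrite /f -rE => fSS'; apply/asboolP.
  exact: design_class_map fSS'.
exists #|B|; split.
  apply: leq_trans Bcard; rewrite card_powerset leq_exp2l //.
  exact: card_andre_norms.
pose h (i : 'I_#|B|) := f (enum_val i).
have hinj : injective h.
  by move=> i j /finj hij; apply: enum_val_inj; apply: hij; exact: enum_valP.
rewrite (card_le_eql card_II) -(card_le_eql (inj_card_eq (in2W hinj))).
apply: subset_card_le => _ [i _ <-]; rewrite /h /f -rE.
exact: design_maximal.
Qed.

(** * The sequence of primes and the asymptotic estimate *)

(** Exponential growth of the primes gives an explicit rate at which the error exponent tends to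
    0. *)
Lemma doubling_primes (m : nat) : exists p : nat -> nat,
  [/\ m < p 0, forall n, prime (p n) & forall n, 2 * p n < p n.+1].
Proof.
pose g k := s2val (prime_above k).
have gP k : k < g k /\ prime (g k) by rewrite /g; case: prime_above.
exists (fun n => iter n (fun q => g (2 * q)) (g m)); split=> [|n|n] /=.
- exact: (gP _).1.
- by case: n => [|n]; exact: (gP _).2.
- exact: (gP _).1.
Qed.

(** Dividing 2^(p-1) by the class size leaves at least 2^(p/2 + 1); the [.+1] makes up for rounding
    p/2 down. *)
Lemma count_bound (p : nat) : 512 < p ->
  2 ^ (p %/ 2).+1 * ((p ^ 2).+1 * p ^ 2) ^ 4 <= 2 ^ p.-1.
Proof.
move=> p512; set s := trunc_log 2 p.
have sp : 2 ^ s <= p by apply: trunc_logP => //; lia.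
have ps : p < 2 ^ s.+1 by exact: trunc_log_ltn.
have s9 : 9 <= s by apply: trunc_log_max => //; apply: ltnW.
(* On exponents the claim is 20 (s + 1) + 2 <= p - p/2, where the right side is at least 2^(s-1).
   This holds from s = 9 on, whence the threshold 512 = 2^9. *)
have lin : 20 * s + 22 <= 2 ^ s.-1.
  have lin k : 20 * k + 202 <= 2 ^ (8 + k).
    by elim: k => // k; rewrite (addnS 8) expnS; lia.
  have <- : 8 + (s - 9) = s.-1 by lia.
  by apply: leq_trans (lin _); lia.
have base : (p ^ 2).+1 * p ^ 2 <= 2 ^ (5 * s.+1).
  apply: (@leq_trans (p ^ 5)).
    by rewrite -[5]/(3 + 2) expnD leq_mul // (expnS p 2); nia.
  by rewrite mulnC expnM leq_exp2r // ltnW.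
apply: (@leq_trans (2 ^ (p %/ 2).+1 * (2 ^ (5 * s.+1)) ^ 4)).
  by rewrite leq_mul // leq_exp2r.
rewrite -expnM -expnD leq_exp2l //.
have : 2 ^ s = 2 * 2 ^ s.-1 by rewrite -expnS prednK //; lia.
by lia.
Qed.

Local Open Scope ring_scope.

(** It suffices that e^(1/2) <= 2, which follows from e^(-1/2) >= 1 - 1/2. *)
Lemma expR_half_nat_le (R : realType) (n : nat) : expR (n%:R / 2 : R) <= (2 ^ n)%:R.
Proof.
rewrite expRM_natl natrX lerXn2r ?nnegrE ?expR_ge0 //.
have : 1 + - 2^-1 <= expR (- 2^-1) :> R by exact: expR_ge1Dx.
rewrite expRN -[leRHS]div1r ler_pdivlMr ?expR_gt0 //; lra.
Qed.

Theorem corollary4p3 (R : realType) :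
  exists (r : nat -> nat) (o : nat -> R),
    [/\ (forall m n : nat, (m < n)%N -> (r m < r n)%N),
        o n @[n --> \oo] --> (0 : R)
      & forall n : nat, exists k : nat,
          expR ((r n)%:R `^ (2^-1 - o n)) <= k%:R :> R /\
          `I_k #<= ryser_maximal (r n)].
Proof.
have [p [p0 p_pr p_dbl]] := doubling_primes 512.
have p_ge n : (512 * 2 ^ n < p n)%N.
  elim: n => [|n IH]; first by rewrite muln1.
  by apply: leq_trans (p_dbl n); rewrite expnS; lia.
have p_gt n : (512 < p n)%N.
  by apply: leq_ltn_trans (p_ge n); rewrite leq_pmulr ?expn_gt0.
have p_mono m n : (m < n)%N -> (p m < p n)%N.
  by apply: (homo_ltn ltn_trans) => i; move: (p_dbl i); lia.
(* With this [o], r^(1/2 - o) = sqrt r / 8. The constant 8 absorbs three factors 2: sqrt r <= 2 p, p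
   <= 2 (p/2 + 1), and the halved exponent in [expR_half_nat_le]. *)
pose r n := (p n ^ 2).+1; pose o n : R := ln 8 / ln (r n)%:R.
have r_gt1 n : 1 < (r n)%:R :> R.
  by rewrite ltr1n /r ltnS expn_gt0 (ltn_trans _ (p_gt n)).
have lnr n : n.+1%:R * ln 2 <= ln (r n)%:R :> R.
  rewrite mulr_natl -lnXn // ler_ln ?posrE ?exprn_gt0 ?(lt_trans ltr01 (r_gt1 n)) //.
  rewrite -natrX ler_nat /r expnS.
  by have := p_ge n; move: (2 ^ n)%N => t; nia.
exists r, o; split=> [m n /p_mono mn| |n].
- by rewrite /r ltnS ltn_exp2r.
(* ln 8 = 3 ln 2 and ln r >= (n + 1) ln 2, so [o n] is at most 3 / (n + 1). *)
- apply: (@squeeze_cvgr _ _ _ _ (fun=> 0) (fun n => 3 * harmonic n)).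
  + near=> n; apply/andP; split.
      by rewrite divr_ge0 ?ln_ge0 // ?ler1n // ltW.
    have ln8 : ln 8 = 3 * ln 2 :> R by rewrite mulr_natl -lnXn // -natrX.
    rewrite /o ln8 /harmonic -mulrA ler_pM2l // ler_pdivrMr ?ln_gt0 //.
    by rewrite [leRHS]mulrC ler_pdivlMr // mulrC.
  + exact: cvg_cst.
  + rewrite -[0 in X in _ --> X](mulr0 3); apply: cvgMl_tmp; exact: cvg_harmonic.
have [k [k_ge kM]] := many_ryser_maximal (p n) (p_pr n).
exists k; split=> //.
have k2 : (2 ^ (p n %/ 2).+1 <= k)%N.
  rewrite -(leq_pmul2r (_ : 0 < ((p n ^ 2).+1 * p n ^ 2) ^ 4)%N); last first.
    by rewrite !(expn_gt0, muln_gt0) (ltn_trans _ (p_gt n)).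
  exact: leq_trans (count_bound _ (p_gt n)) k_ge.
apply: le_trans (_ : (2 ^ (p n %/ 2).+1)%:R <= _); last by rewrite ler_nat.
apply: le_trans (expR_half_nat_le _ _); rewrite ler_expR.
have r_neq0 : (r n)%:R != 0 :> R by rewrite pnatr_eq0.
rewrite powRB ?r_neq0 ?implybT // powR12_sqrt //.
have -> : (r n)%:R `^ o n = 8.
  rewrite /powR (negbTE r_neq0) /o divfK ?lnK ?posrE //.
  by rewrite gt_eqF ?ln_gt0.
have sqrt_r : Num.sqrt (r n)%:R <= 2 * (p n)%:R :> R.
  rewrite -[leRHS]ger0_norm ?mulr_ge0 // -sqrtr_sqr ler_sqrt ?sqr_ge0 //.
  rewrite -natrM -natrX ler_nat /r expnMn.
  have : (0 < p n ^ 2)%N by rewrite expn_gt0 (ltn_trans _ (p_gt n)).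
  by move: (p n ^ 2)%N => q; lia.
have : (p n)%:R <= 2 * (p n %/ 2).+1%:R :> R.
  by rewrite -natrM ler_nat; lia.
by move: sqrt_r; lra.
Unshelve. all: by end_near.
Qed.
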